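(* Let $n\geq 2$ and $\ell\geq 1$ be integers. Then $\mathcal{E}(n)=\ell$ if and only if $T_\ell(n)=\{0\}$.
   Context: For integers $b$ and $k\ge 1$, $b\bmod k$ denotes the least nonnegative residue of $b$ modulo $k$. For a positive integer $n$, define \[ T_0(n):=\{1,2,\ldots,n-1\},\qquad T_{j+1}(n):=\{(-n)\bmod k : k\in T_j(n)\setminus\{0\}\}\quad (j\ge 0). \] For integers $1\le a\le n$, set $a_0:=a$ and, as long as $a_j>0$, $a_{j+1}:=(-n)\bmod a_j$. Let $\mathcal E(n,a)$ be the least integer $j\ge 1$ for which $a_j=0$, and $\mathcal E(n):=\max_{1\le a\le n}\mathcal E(n,a)$. *)

(* Defs.v *)
From mathcomp Require Import all_boot all_algebra finmap.

Set Implicit Arguments.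
Unset Strict Implicit.
Unset Printing Implicit Defensive.

(* (-n) mod k as a natural number. Only meaningful for k > 0: intdiv sets
   (m %% 0)%Z = m, and every use below excludes k = 0. *)
Definition negmod (n k : nat) : nat := `|((- Posz n)%R %% Posz k)%Z|%N.

Lemma negmodE (n k : nat) : 0 < k -> Posz (negmod n k) = ((- Posz n)%R %% Posz k)%Z.
Proof. by move=> k_gt0; rewrite /negmod gez0_abs // modz_ge0 // -lt0n. Qed.

Lemma ltn_negmod (n k : nat) : 0 < k -> negmod n k < k.
Proof. by move=> k_gt0; rewrite -ltz_nat negmodE // ltz_pmod. Qed.

Fixpoint T (n j : nat) : {fset nat} :=
  match j with
  | 0 => [fset k in iota 1 n.-1]%fset
  | i.+1 => [fset negmod n k | k in (T n i `\ 0)%fset]%fset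
  end.

(* The sequence a_0 = a, a_{j+1} = (-n) mod a_j. It is defined only up to its
   first zero term; it is continued by 0 afterwards. *)
Fixpoint pseq (n a j : nat) : nat :=
  match j with
  | 0 => a
  | i.+1 => if 0 < pseq n a i then negmod n (pseq n a i) else 0
  end.

Lemma pseq_hits0 (n a : nat) : exists j, (0 < j) && (pseq n a j == 0).
Proof.
have le_pseq j : pseq n a j <= a - j.
  elim: j => [|j IHj] /=; first by rewrite subn0.
  case: ifP => [p_gt0|//].
  by rewrite subnS -ltnS prednK ?(leq_trans p_gt0) // (leq_trans (ltn_negmod n p_gt0)).
by exists a.+1; have := le_pseq a.+1; rewrite subnS subnn leqn0 => ->.
Qed.

Definition Ena (n a : nat) : nat := ex_minn (pseq_hits0 n a).

Definition En (n : nat) : nat := \max_(1 <= a < n.+1) Ena n a.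

(* Main.v *)
Require Import Defs.
From mathcomp Require Import all_boot all_algebra finmap.

(** [T n j] collects the [j]-th terms of all sequences started in [1, n - 1]
    that have not stopped before step [j], that is, those with [j <= Ena n a]
    ([in_TP]). The [j]-th term of such a sequence vanishes exactly when
    [Ena n a <= j], so [T n j] contains no nonzero number if and only if every
    sequence has length at most [j], i.e. [En n <= j] ([T_sub0E]). The starting
    value [n], absent from [T n 0], does not affect the maximum, because its
    sequence has length 1 ([En_leP]).

    On the other hand [T n j.+1] is the image of the nonzero part of [T n j],
    hence is empty exactly when [T n j] is included in {0} ([T_S_eq0]).
    Therefore [T n l] is {0}, i.e. included in {0} and nonempty, if and only if
    [En n <= l] holds and [En n <= l - 1] fails. *)

(** Zero is absorbing for [pseq], so the first zero at a positive index
    separates the positive terms from the zero ones; [0 < a] is what rules out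
    a zero at index 0, which [Ena] would miss. *)
Lemma pseq_gt0 (n a j : nat) : 0 < a -> (0 < pseq n a j) = (j < Ena n a).
Proof.
move=> a_gt0; rewrite /Ena; case: ex_minnP => m /andP[m_gt0 /eqP pm0] m_min.
apply/idP/idP => [|lt_jm].
  apply: contraTT; rewrite -leqNgt => /subnK <-.
  by elim: (j - m) => [|i IHi]; rewrite ?add0n ?pm0 //= (negbTE IHi).
rewrite lt0n; apply/negP => pj0; case: j lt_jm pj0 => [|j] lt_jm pj0.
  by move: a_gt0; rewrite lt0n pj0.
by have := m_min j.+1; rewrite pj0 => /(_ isT); rewrite leqNgt lt_jm.
Qed.

Lemma pseq_eq0 (n a j : nat) : 0 < a -> (pseq n a j == 0) = (Ena n a <= j).
Proof. by move=> a_gt0; rewrite leqNgt -pseq_gt0 // lt0n negbK. Qed.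

Lemma Ena_gt0 (n a : nat) : 0 < Ena n a.
Proof. by rewrite /Ena; case: ex_minnP => m /andP[]. Qed.

Lemma Ena_self (n : nat) : 0 < n -> Ena n n <= 1.
Proof. by move=> n_gt0; rewrite -pseq_eq0 //= n_gt0 /negmod -GRing.mulN1r modzMl. Qed.

(** The index [n] of the maximum can be dropped: it contributes at most 1,
    which the index 1, present since [2 <= n], already reaches. *)
Lemma En_leP (n m : nat) : 2 <= n ->
  reflect (forall a, 0 < a < n -> Ena n a <= m) (En n <= m).
Proof.
move=> n_ge2; apply: (iffP (bigmax_leqP_seq _ _ _ _)) => [le_m a /andP[a0 ltan]|le_m a].
  by apply: le_m; rewrite // mem_index_iota a0 ltnW.
rewrite mem_index_iota => /andP[a0]; rewrite ltnS leq_eqVlt => /predU1P[->|ltan] _.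
  apply: leq_trans (Ena_self n (ltnW n_ge2)) (leq_trans (Ena_gt0 n 1) _).
  exact: le_m.
by apply: le_m; rewrite a0.
Qed.

(** The induction works because discarding 0 from [T n j] discards exactly the
    [j]-th terms of the sequences of length [j], by [pseq_gt0]: the bound
    [j <= Ena n a] becomes [j.+1 <= Ena n a]. *)
Lemma in_TP (n j x : nat) :
  x \in T n j <->
  exists a, [/\ 0 < a < n, j <= Ena n a & pseq n a j = x].
Proof.
elim: j x => [|j IHj] x /=.
  rewrite inE /= mem_iota; split=> [|[a [an _ <-]]].
    move=> xn; exists x; split=> //; case: n xn => [|n] //.
    by case/andP=> /leq_trans le1 /le1.
  by case: n an => [|n] //; rewrite ltn0 andbF.
split=> [/imfsetP[k /= + ->]|[a [an lt_jE <-]]].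
  rewrite !inE => /andP[k_neq0 /IHj[a [an _ def_k]]].
  have a_gt0: 0 < a by case/andP: an.
  by exists a; split; rewrite -?pseq_gt0 // def_k lt0n k_neq0.
have pj_gt0: 0 < pseq n a j by rewrite pseq_gt0 //; case/andP: an.
rewrite pj_gt0; apply: in_imfset; rewrite /= !inE -lt0n pj_gt0 /=.
by apply/IHj; exists a; split=> //; apply: ltnW.
Qed.

Lemma T_sub0E (n j : nat) : 2 <= n ->
  (T n j `<=` [fset 0])%fset = (En n <= j).
Proof.
move=> n_ge2; apply/fsubsetP/En_leP => //= [sub0 a an|leE x].
  have /andP[a_gt0 _] := an; rewrite leqNgt; apply/negP => lt_jE.
  have /sub0: pseq n a j \in T n j by apply/in_TP; exists a; split=> //; apply: ltnW.
  by rewrite inE pseq_eq0 // leqNgt lt_jE.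
case/in_TP=> a [an _ <-]; have /andP[a_gt0 _] := an.
by rewrite inE pseq_eq0 // leE.
Qed.

Lemma T_S_eq0 (n j : nat) :
  (T n j.+1 == fset0) = (T n j `<=` [fset 0])%fset.
Proof.
rewrite -fsetD_eq0 /=; apply/eqP/eqP => [T0|->]; last by rewrite imfset0.
apply/fsetP => k; rewrite [RHS]inE; apply/negP => k_in.
have: negmod n k \in (fset0 : {fset nat}) by rewrite -T0 in_imfset.
by rewrite inE.
Qed.

Theorem lemma1p3 (n l : nat) (hn : 2 <= n) (hl : 1 <= l) :
  En n = l <-> T n l = [fset 0]%fset.
Proof.
case: l hl => // l _.
have ->: (T n l.+1 = [fset 0]%fset) <->
         (T n l.+1 `<=` [fset 0])%fset && (T n l.+1 != fset0).
  split=> [->|/andP[]]; last by rewrite fsubset1 => /orP[/eqP|->].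
  by rewrite fsubset_refl -cardfs_eq0 cardfs1.
rewrite T_S_eq0 !T_sub0E // -ltnNge -eqn_leq.
by split=> /eqP.
Qed.
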